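(* Let $\mathbb K$ be an algebraically closed field. Let $f\colon\mathbb N\to\mathbb N$ be a function with positive values that is submultiplicative ($f(m+n)\le f(m)f(n)$ for all $m,n$) and increasing ($f(n+1)\ge f(n)$ for all $n$), and such that there is a positive integer $C$ with $f(Cn)\ge n f(n)$ for all $n\in\mathbb N$. Then there exists a finitely generated associative $\mathbb K$-algebra with growth $\sim f$.
   Context: $\mathbb N=\{0,1,2,\dots\}$. For an associative algebra $R$ generated by a finite dimensional subspace $S$, its growth is the function $v(n)=\dim(1+S+S^2+\cdots+S^n)$. For functions $v,v'$, write $v\precsim v'$ if there is a constant (positive integer) $C'$ with $v(n)\le v'(C'n)$ for all $n\ge1$, and $v\sim v'$ if $v\precsim v'$ and $v'\precsim v$. The class of $v$ under $\sim$ does not depend on $S$. *)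

(* Defs.v *)
From HB Require Import structures.
From mathcomp Require Import all_boot all_order all_algebra.
From mathcomp Require Import boolp classical_sets.

Set Implicit Arguments.
Unset Strict Implicit.
Unset Printing Implicit Defensive.

Import GRing.Theory.

Local Open Scope classical_set_scope.
Local Open Scope ring_scope.

Section LinearAlgebra.
Variables (K : fieldType) (V : lmodType K).

Definition subspace (W : set V) : Prop :=
  GRing.submod_closed [in W].

Definition span (X : set V) : set V := smallest subspace X.

Definition lin_indep (d : nat) (b : 'I_d -> V) : Prop :=
  forall c : 'I_d -> K, \sum_i c i *: b i = 0 -> forall i, c i = 0.

Definition has_dim (W : set V) (d : nat) : Prop :=
  exists b : 'I_d -> V, lin_indep b /\ span (range b) = W.

Definition finite_dim (W : set V) : Prop := exists d, has_dim W d.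

(* Junk value 0 when W is not a finite-dimensional subspace. *)
Definition dim (W : set V) : nat := xget 0%N (has_dim W).

End LinearAlgebra.

Section Growth.
Variables (K : fieldType) (A : algType K).

(* Algebras are unital, so a generated subalgebra always contains 1. *)
Definition generates (S : set A) : Prop :=
  smallest (fun B : set A => GRing.subalg_closed [in B]) S = setT.

Definition subspace_mul (U W : set A) : set A :=
  span [set x * y | x in U & y in W].

(* S^0 is the line K.1. *)
Definition subspace_exp (S : set A) (n : nat) : set A :=
  iter n (subspace_mul S) (span [set 1]).

(* 1 + S + S^2 + ... + S^n *)
Definition growth_space (S : set A) (n : nat) : set A :=
  [set \sum_(i < n.+1) x i |
     x in [set x : 'I_n.+1 -> A | forall i : 'I_n.+1, subspace_exp S i (x i)]].

Definition growth (S : set A) (n : nat) : nat := dim (growth_space S n).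

End Growth.

Definition growth_le (v w : nat -> nat) : Prop :=
  exists2 C : nat, (0 < C)%N & forall n, (1 <= n)%N -> (v n <= w (C * n))%N.

Definition growth_equiv (v w : nat -> nat) : Prop :=
  growth_le v w /\ growth_le w v.

(* The growth class does not depend on the choice of the generating
   subspace S, so one S is enough. *)
Definition fg_with_growth (K : fieldType) (A : algType K) (f : nat -> nat) :
    Prop :=
  exists S : set A, [/\ subspace S, finite_dim S, generates S &
    growth_equiv (growth S) f].

(* Main.v *)
(* For a factor-closed language L, the functions on words that are supported on
   finitely many words of L form, under convolution truncated to L, the monomial
   algebra of L, and its growth counts the words of L of length at most n.

   The language consists of the factors of the words of W_k (of length 2^k),
   where W_0 is an alphabet of f(1) letters and W_(k+1) = C_k W_k for an initial
   segment C_k of W_k chosen so that |W_k| lies between f(2^k) and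
   (k+1) f(2^k); submultiplicativity ensures that W_k is large enough for this.
   Two consecutive W_k-blocks always form a word of C_k W_k or of W_k C_k, so
   there are at most 2 |W_(k+1)| of them and the number of words of length at
   most n is f(O(n)) up to a polynomial factor, which f(Cn) >= n f(n)
   absorbs. *)
From HB Require Import structures.
From mathcomp Require Import all_boot all_order all_algebra zify.
From mathcomp Require Import boolp classical_sets functions.
Require Import Defs.

Set Implicit Arguments.
Unset Strict Implicit.
Unset Printing Implicit Defensive.

Import GRing.Theory.

(** * Convolution of functions on words *)

Section Convolution.
Local Open Scope ring_scope.
Variables (K : fieldType) (I : eqType).
Implicit Types (a b c : seq I -> K) (w : seq I).

(** The sum of [a u * b v] over all factorizations [w = u ++ v]; the recursion moves the first
    letter of [w] into the argument of [a]. *)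
Fixpoint conv a b w : K :=
  if w is x :: w' then a [::] * b w + conv (fun u => a (x :: u)) b w'
  else a [::] * b [::].

Lemma eq_conv a b a' b' w :
    (forall u v, w = u ++ v -> a u * b v = a' u * b' v) ->
  conv a b w = conv a' b' w.
Proof.
elim: w a a' => [|x w IHw] a a' eqab /=; first exact: (eqab [::] [::]).
rewrite (eqab [::] (x :: w)) //; congr (_ + _).
by apply: IHw => u v eqw; apply: (eqab (x :: u) v); rewrite eqw.
Qed.

Lemma conv_eq0 a b w :
  (forall u v, w = u ++ v -> a u * b v = 0) -> conv a b w = 0.
Proof.
move=> ab0; rewrite (@eq_conv _ _ (fun=> 0) (fun=> 0)).
  by elim: w {ab0} => [|x w /= ->]; rewrite /= mul0r ?add0r.
by move=> u v /ab0 ->; rewrite mul0r.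
Qed.

Lemma convDl a b c w : conv (fun u => a u + b u) c w = conv a c w + conv b c w.
Proof.
elim: w a b => [|x w IHw] a b /=; first by rewrite mulrDl.
by rewrite IHw mulrDl addrACA.
Qed.

Lemma convDr a b c w : conv a (fun u => b u + c u) w = conv a b w + conv a c w.
Proof.
elim: w a => [|x w IHw] a /=; first by rewrite mulrDr.
by rewrite IHw mulrDr addrACA.
Qed.

Lemma convZl k a b w : conv (fun u => k * a u) b w = k * conv a b w.
Proof.
elim: w a => [|x w IHw] a /=; first by rewrite mulrA.
by rewrite IHw mulrDr mulrA.
Qed.

Lemma convZr k a b w : conv a (fun u => k * b u) w = k * conv a b w.
Proof.
elim: w a => [|x w IHw] a /=; first by rewrite mulrCA.
by rewrite IHw mulrDr mulrCA.
Qed.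

Lemma convA a b c w : conv a (conv b c) w = conv (conv a b) c w.
Proof.
elim: w a b => [|x w IHw] a b /=; first by rewrite mulrA.
by rewrite convDl convZl IHw mulrDr !mulrA addrA.
Qed.

(** Only one factorization of [w] can have [u] as its left part, so at most one term survives. *)
Lemma conv_word u a w :
  conv (fun z => (z == u)%:R) a w =
  if prefix u w then a (drop (size u) w) else 0.
Proof.
elim: u w => [|x u IHu] w.
  case: w => [|y w] /=; rewrite mul1r // conv_eq0 ?addr0 //.
  by move=> u v _; rewrite mul0r.
case: w => [|y w]; first by rewrite /= mul0r.
rewrite /= mul0r add0r.
have [->|neq_yx] := eqVneq x y.
  by rewrite -IHu; apply: eq_conv => z v _; rewrite eqseq_cons eqxx.
apply: conv_eq0 => z v _.
by rewrite eqseq_cons eq_sym (negPf neq_yx) mul0r.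
Qed.

End Convolution.

(** * The monomial algebra of a factor-closed language *)

Record language (I : finType) := Language {
  lang :> pred (seq I);
  lang_nil : lang [::];
  lang_cat : forall u v, lang (u ++ v) -> lang u && lang v }.

Section MonomialAlgebra.
Local Open Scope ring_scope.
Variables (K : fieldType) (I : finType) (L : language I).

(** As the alphabet is finite, bounded length of the support amounts to finite support. *)
Definition poly_supp (a : seq I -> K^o) : bool :=
  `[< exists n, forall w, a w != 0 -> L w && (size w <= n)%N >].

Fact poly_supp_submod : GRing.submod_closed poly_supp.
Proof.
split=> [|k a b /asboolP[n an] /asboolP[m bm]]; apply/asboolP.
  by exists 0%N => w; rewrite eqxx.
exists (maxn n m) => w; rewrite leq_max.
have [aw0|/an/andP[-> ->]] // := eqVneq (a w) 0.
have [bw0|/bm/andP[-> ->]] := eqVneq (b w) 0; last by rewrite orbT.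
have -> : (k *: a + b) w = k * a w + b w by [].
by rewrite aw0 bw0 mulr0 addr0 eqxx.
Qed.

HB.instance Definition _ :=
  GRing.isSubmodClosed.Build K (seq I -> K^o) poly_supp poly_supp_submod.

Record monalg := Monalg { coef :> seq I -> K^o; _ : coef \in poly_supp }.

HB.instance Definition _ := [isSub for coef].
HB.instance Definition _ := [Choice of monalg by <:].
HB.instance Definition _ := [SubChoice_isSubLmodule of monalg by <:].

Lemma coefP (a : monalg) :
  exists n, forall w, a w != 0 -> L w && (size w <= n)%N.
Proof. by case: a => a /= /asboolP. Qed.

Lemma coef_lang (a : monalg) w : ~~ L w -> a w = 0.
Proof. by have [n an] := coefP a; apply: contraNeq => /an/andP[]. Qed.

Lemma monalg_ext (a b : monalg) : (forall w, L w -> a w = b w) -> a = b.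
Proof.
move=> eqab; apply/val_inj/funext => w /=.
by have [/eqab//|nLw] := boolP (L w); rewrite !coef_lang.
Qed.

Fact coef_word_subproof u : 
  (fun w => (L u && (w == u))%:R : K^o) \in poly_supp.
Proof.
apply/asboolP; exists (size u) => w.
by case: andP => [[Lu /eqP->]|]; rewrite ?Lu ?leqnn ?eqxx.
Qed.

(** Zero when [u] is outside [L], so no membership proof is carried along. *)
Definition word u := Monalg (coef_word_subproof u).

Fact coef_mul_subproof (a b : monalg) :
  (fun w => (if L w then conv a b w else 0) : K^o) \in poly_supp.
Proof.
apply/asboolP; have [[n an] [m bm]] := (coefP a, coefP b).
exists (n + m)%N => w; case: ifP => [Lw|]; last by rewrite eqxx.
apply: contraR => lt_w; rewrite conv_eq0 // => u v eq_w.
have [->|/an/andP[_ un]] := eqVneq (a u) 0; first by rewrite mul0r.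
have [->|/bm/andP[_ vm]] := eqVneq (b v) 0; first by rewrite mulr0.
by rewrite eq_w size_cat leq_add in lt_w.
Qed.

Definition mul_monalg a b := Monalg (coef_mul_subproof a b).

Lemma mul_monalgE a b w : L w -> mul_monalg a b w = conv a b w.
Proof. by rewrite /= => ->. Qed.

Lemma coefD (a b : monalg) w : (a + b) w = a w + b w.
Proof. by []. Qed.

Lemma coefZ k (a : monalg) w : (k *: a) w = k * a w.
Proof. by []. Qed.

(** Factors of a word of [L] lie in [L], so on such a word the inner truncation never acts and
    [convA] applies. *)
Fact mul_monalgA : associative mul_monalg.
Proof.
move=> a b c; apply: monalg_ext => w Lw; rewrite !mul_monalgE //.
transitivity (conv a (conv b c) w).
  by apply: eq_conv => u v eq_w; rewrite mul_monalgE //; move: Lw;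
    rewrite eq_w => /lang_cat/andP[].
rewrite convA; apply: eq_conv => u v eq_w; rewrite mul_monalgE //; move: Lw.
by rewrite eq_w => /lang_cat/andP[].
Qed.

Fact mul_wordl u a w : L u -> L w ->
  mul_monalg (word u) a w = if prefix u w then a (drop (size u) w) else 0.
Proof.
move=> Lu Lw; rewrite mul_monalgE // -conv_word.
by apply: eq_conv => z v _; rewrite /= Lu.
Qed.

Fact mul1_monalg : left_id (word [::]) mul_monalg.
Proof.
move=> a; apply: monalg_ext => w Lw.
by rewrite mul_wordl ?lang_nil // prefix0s drop0.
Qed.

Fact mul_monalg1 : right_id (word [::]) mul_monalg.
Proof.
move=> a; apply: monalg_ext => w Lw; rewrite mul_monalgE //=.
(* The induction needs bare functions, since it passes from [a] to [fun u => a (x :: u)]. *)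
move: (coef a) => {}a; elim: w a {Lw} => [|x w IHw] a /=.
  by rewrite lang_nil mulr1.
by rewrite andbF mulr0 add0r (IHw (fun u => a (x :: u))).
Qed.

Fact mul_monalgDl : left_distributive mul_monalg +%R.
Proof.
move=> a b c; apply: monalg_ext => w Lw.
by rewrite coefD !mul_monalgE // -convDl.
Qed.

Fact mul_monalgDr : right_distributive mul_monalg +%R.
Proof.
move=> a b c; apply: monalg_ext => w Lw.
by rewrite coefD !mul_monalgE // -convDr.
Qed.

Fact word_nil_neq0 : word [::] != 0.
Proof.
apply/eqP => /(congr1 (fun a : monalg => a [::])) /=.
by rewrite lang_nil => /eqP; rewrite oner_eq0.
Qed.

HB.instance Definition _ := GRing.Zmodule_isNzRing.Build monalg
  mul_monalgA mul1_monalg mul_monalg1 mul_monalgDl mul_monalgDr word_nil_neq0.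

Fact mul_monalgZl (k : K) (a b : monalg) : k *: (a * b) = k *: a * b.
Proof.
apply: monalg_ext => w Lw.
by rewrite coefZ !mul_monalgE // -convZl.
Qed.

HB.instance Definition _ :=
  GRing.Lmodule_isLalgebra.Build K monalg mul_monalgZl.

Fact mul_monalgZr (k : K) (a b : monalg) : k *: (a * b) = a * (k *: b).
Proof.
apply: monalg_ext => w Lw.
by rewrite coefZ !mul_monalgE // -convZr.
Qed.

HB.instance Definition _ := GRing.Lalgebra_isAlgebra.Build K monalg mul_monalgZr.

End MonomialAlgebra.

(** * Spans and dimension *)

Section Dimension.
Local Open Scope ring_scope.
Local Open Scope classical_set_scope.
Variables (K : fieldType) (V : lmodType K).
Implicit Types (W X : set V).

Lemma subspaceP W :
  subspace W <-> W 0 /\ forall k x y, W x -> W y -> W (k *: x + y).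
Proof.
split=> -[W0 WD]; split; rewrite ?inE // in W0 *.
  by move=> k x y Wx Wy; have := WD k x y; rewrite !inE; apply.
by move=> k x y; rewrite !inE; apply: WD.
Qed.

Lemma subspace_sum W (T : Type) (r : seq T) (P : pred T) (F : T -> V) :
  subspace W -> (forall i, P i -> W (F i)) -> W (\sum_(i <- r | P i) F i).
Proof.
move=> /subspaceP[W0 WD] WF; apply: (big_ind W) => // x y Wx Wy.
by rewrite -[x]scale1r; apply: WD.
Qed.

Lemma subspaceZ W k x : subspace W -> W x -> W (k *: x).
Proof. by move=> /subspaceP[W0 WD] Wx; rewrite -[k *: x]addr0; apply: WD. Qed.

Lemma span_subspace X : subspace (span X).
Proof.
apply/subspaceP; split=> [W [/subspaceP[]//]|k x y Xx Xy W WX].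
by have [/subspaceP[_ WD] _] := WX; apply: WD; [apply: Xx | apply: Xy].
Qed.

Lemma sub_span X : X `<=` span X.
Proof. exact: sub_smallest. Qed.

Lemma span_min X W : subspace W -> X `<=` W -> span X `<=` W.
Proof. exact: smallest_sub. Qed.

Lemma span_range (d : nat) (b : 'I_d -> V) x :
  span (range b) x -> exists c : 'I_d -> K, x = \sum_i c i *: b i.
Proof.
move: x; apply: span_min => [|_ [i _ <-]]; last first.
  exists (fun j => (j == i)%:R); rewrite (bigD1 i) //= eqxx scale1r big1 ?addr0 //.
  by move=> j /negPf ->; rewrite scale0r.
apply/subspaceP; split=> [|k _ _ [c ->] [c' ->]].
  by exists (fun=> 0); rewrite big1 // => i _; rewrite scale0r.
exists (fun i => k * c i + c' i).
rewrite scaler_sumr -big_split; apply: eq_bigr => i _ /=.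
by rewrite scalerDl scalerA.
Qed.

(** Writing each [b i] through [c] gives a [d] by [e] matrix. A vector in its left kernel is a
    linear relation among the [b i], so the kernel is zero and the rank, at most [e], equals [d]. *)
Lemma lin_indep_leq (d e : nat) (b : 'I_d -> V) (c : 'I_e -> V) :
  lin_indep b -> (forall i, span (range c) (b i)) -> (d <= e)%N.
Proof.
move=> indep_b bc; have [m bm] := choice (fun i => span_range (bc i)).
pose M : 'M[K]_(d, e) := \matrix_(i, j) m i j.
suff: kermx M == 0.
  rewrite -mxrank_eq0 mxrank_ker subn_eq0 => le_d.
  by rewrite (leq_trans le_d) // rank_leq_col.
apply/eqP/row_matrixP => r; rewrite row0; apply/rowP => i; rewrite [RHS]mxE.
apply: (indep_b (row r (kermx M) ord0)).
under eq_bigr => j _ do rewrite bm scaler_sumr.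
rewrite exchange_big big1 //= => j _.
under eq_bigr => l _ do rewrite scalerA.
rewrite -scaler_suml.
have rM0 : (row r (kermx M) *m M) ord0 j = 0.
  by rewrite -row_mul mulmx_ker row0 mxE.
rewrite mxE in rM0.
suff -> : \sum_l row r (kermx M) ord0 l * m l j = 0 by rewrite scale0r.
by rewrite -[RHS]rM0; apply: eq_bigr => l _; rewrite [M _ _]mxE.
Qed.

Lemma has_dim_inj W d e : has_dim W d -> has_dim W e -> d = e.
Proof.
move=> [b [indep_b spanb]] [c [indep_c spanc]]; apply/eqP.
rewrite eqn_leq (lin_indep_leq indep_b (c := c)) ?(lin_indep_leq indep_c (c := b)) //.
  by move=> i; rewrite spanb -spanc; apply: sub_span; exists i.
by move=> i; rewrite spanc -spanb; apply: sub_span; exists i.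
Qed.

Lemma dimE W d : has_dim W d -> dim W = d.
Proof. by move=> Wd; apply: xget_unique => // e We; apply: has_dim_inj We Wd. Qed.

End Dimension.

(** * Growth of a monomial algebra as a count of words *)

Section MonomialGrowth.
Local Open Scope ring_scope.
Local Open Scope classical_set_scope.
Variables (K : fieldType) (I : finType) (L : language I).
Local Notation A := (monalg K L).
Local Notation word := (word K L).
Implicit Types (a b : A) (u v w : seq I) (P : pred (seq I)).

Lemma wordE u w : L u -> word u w = (w == u)%:R.
Proof. by rewrite /= => ->. Qed.

Lemma coef1 w : (1 : A) w = (w == [::])%:R.
Proof. exact: (wordE w (lang_nil L)). Qed.

Lemma word_nil : word [::] = 1.
Proof. by []. Qed.

Lemma coef_sum (T : Type) (r : seq T) (P : pred T) (F : T -> A) w :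
  (\sum_(i <- r | P i) F i) w = \sum_(i <- r | P i) F i w.
Proof. by apply: (big_morph (fun a : A => a w)). Qed.

Lemma word_cat u v : L (u ++ v) -> word u * word v = word (u ++ v).
Proof.
move=> Luv; have /andP[Lu Lv] := lang_cat Luv.
apply: monalg_ext => w Lw; rewrite [LHS]mul_wordl // !wordE //.
case: ifP => [/prefixP[z ->]|].
  by rewrite drop_size_cat // eqseq_cat // eqxx.
by have [->|] := eqVneq w (u ++ v); rewrite ?prefix_prefix.
Qed.

Definition lang_words (n : nat) : seq (seq I) :=
  [seq w <- [seq val t | t : {bseq n of I}] | L w].

Lemma mem_lang_words n w : (w \in lang_words n) = L w && (size w <= n)%N.
Proof.
rewrite mem_filter; congr (_ && _).
apply/mapP/idP => [[t _ ->]|le_w]; first exact: size_bseq.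
by exists (Bseq le_w); rewrite ?mem_enum.
Qed.

Lemma lang_words_uniq n : uniq (lang_words n).
Proof. by rewrite filter_uniq // map_inj_uniq ?enum_uniq //; apply: val_inj. Qed.

(** Every space arising in the growth has this form, which turns questions on spans into questions
    on words. *)
Definition supp_in P : set A := [set a | forall w, a w != 0 -> P w].

Lemma supp_in_subspace P : subspace (supp_in P).
Proof.
apply/subspaceP; split=> [w|k a b aP bP w]; first by rewrite eqxx.
have [aw0|/aP//] := eqVneq (a w) 0; have [bw0|/bP//] := eqVneq (b w) 0.
by rewrite coefD coefZ aw0 bw0 mulr0 addr0 eqxx.
Qed.

Lemma supp_in_word P w : P w -> supp_in P (word w).
Proof.
move=> Pw u; rewrite /=.
by case: andP => [[_ /eqP->]|]; rewrite // eqxx.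
Qed.

Lemma monalg_sum (s : seq (seq I)) a : uniq s -> supp_in (mem s) a ->
  a = \sum_(w <- s) (a w : K) *: word w.
Proof.
move=> uniq_s sa; apply: monalg_ext => w Lw; rewrite coef_sum.
have coef_wu u : ((a u : K) *: word u) w = if u == w then a w else 0.
  rewrite coefZ /= [w == u]eq_sym.
  by have [->|_] := eqVneq u w; rewrite ?Lw ?mulr1 ?andbF ?mulr0.
under eq_bigr => u _ do rewrite coef_wu.
rewrite -big_mkcond /= -big_filter.
have [ws|nws] := boolP (w \in s); first by rewrite filter_pred1_uniq // big_seq1.
rewrite big_filter big_seq_cond big1 => [|u /andP[us /eqP eq_uw]].
  by apply/eqP; apply: contraNT nws => /sa.
by rewrite eq_uw (negPf nws) in us.
Qed.

Lemma supp_lang_words a : exists n, supp_in (mem (lang_words n)) a.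
Proof.
by have [n an] := coefP a; exists n => w /an; rewrite /= mem_lang_words.
Qed.

Lemma subspace_words (W : set A) P a : subspace W -> supp_in P a ->
  (forall w, L w -> P w -> W (word w)) -> W a.
Proof.
move=> subW Pa Ww; have [n na] := supp_lang_words a.
rewrite (monalg_sum (lang_words_uniq n) na) big_seq; apply: subspace_sum => // w.
rewrite mem_lang_words => /andP[Lw _].
have [->|/Pa Pw] := eqVneq (a w) 0.
  by rewrite scale0r; case/subspaceP: subW.
by apply: subspaceZ => //; apply: Ww.
Qed.

Lemma span_supp_in (X : set A) P : X `<=` supp_in P ->
  (forall w, L w -> P w -> span X (word w)) -> span X = supp_in P.
Proof.
move=> XP Xw; apply/seteqP; split=> [|a Pa].
  exact: span_min (supp_in_subspace P) XP.
by apply: (subspace_words _ Pa) => //; apply: span_subspace.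
Qed.

Lemma has_dim_supp_in (s : seq (seq I)) : uniq s -> all L s ->
  has_dim (supp_in (mem s)) (size s).
Proof.
move=> uniq_s /allP sL; exists (fun i : 'I_(size s) => word (nth [::] s i)); split.
  (* Taking the coefficient at the [i]-th word isolates [c i]. *)
  move=> c /(congr1 (fun a : A => a _)) c0 i; have := c0 (nth [::] s i).
  rewrite coef_sum (eq_bigr (fun j => if i == j then c j else 0)) => [|j _].
    by rewrite -big_mkcond (big_pred1 i) // => j; rewrite eq_sym.
  rewrite coefZ wordE ?sL ?mem_nth // nth_uniq // val_eqE.
  by case: eqVneq => _; rewrite ?mulr1 ?mulr0.
apply: span_supp_in => [_ [i _ <-]|w _ /= sw].
  by apply: supp_in_word; apply: mem_nth.
have lt_w : (index w s < size s)%N by rewrite index_mem.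
by apply: sub_span; exists (Ordinal lt_w) => //=; rewrite nth_index.
Qed.

Definition letters : set A := supp_in (fun w => size w == 1%N).

(** Lengths add under the product; conversely, a word of [L] is its first letter times the rest, and
    both factors are in [L]. *)
Lemma letters_exp n : subspace_exp letters n = supp_in (fun w => size w == n).
Proof.
rewrite /subspace_exp; elim: n => [|n IHn] /=.
  apply: span_supp_in => [_ -> w|w _ /nilP->]; last exact: sub_span.
  by rewrite coef1; case: (w =P [::]) => [->|_]; rewrite ?eqxx.
rewrite {}IHn; apply: span_supp_in => [_ [a a1 [b bn <-]] w|[|x w] // Lxw /eqP[wn]].
  apply: contraNT => neq_w; have [Lw|nLw] := boolP (L w); last by rewrite coef_lang.
  rewrite [_ w]mul_monalgE // conv_eq0 // => u v eq_w.
  have [->|/a1 /eqP u1] := eqVneq (a u) 0; first by rewrite mul0r.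
  have [->|/bn /eqP vn] := eqVneq (b v) 0; first by rewrite mulr0.
  by rewrite eq_w size_cat u1 vn eqxx in neq_w.
apply: sub_span; exists (word [:: x]); first exact: supp_in_word.
by exists (word w); [apply/supp_in_word/eqP | rewrite word_cat].
Qed.

Lemma letters_growth_space n :
  growth_space letters n = supp_in (mem (lang_words n)).
Proof.
apply/seteqP; split=> [_ [x /= x_hom <-]|a na].
  apply: (@subspace_sum _ _ (supp_in _)) => [|i _]; first exact: supp_in_subspace.
  move=> w; rewrite /= mem_lang_words => xw_neq0.
  have := x_hom i; rewrite letters_exp => /(_ w xw_neq0) /eqP ->.
  by rewrite -ltnS ltn_ord andbT; apply: contraNT xw_neq0 => /coef_lang ->.
(* The summands are the homogeneous components of [a]. *)
exists (fun i : 'I_n.+1 =>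
  \sum_(w <- lang_words n | size w == i) (a w : K) *: word w) => /= [i|].
  rewrite letters_exp; apply: (@subspace_sum _ _ (supp_in _)) => [|w wi].
    exact: supp_in_subspace.
  by apply: (@subspaceZ _ _ (supp_in _)); [apply: supp_in_subspace | apply: supp_in_word].
rewrite [RHS](monalg_sum (lang_words_uniq n) na) (exchange_big_dep predT) //=.
rewrite !big_seq; apply: eq_bigr => w; rewrite mem_lang_words => /andP[_ le_w].
rewrite (big_pred1 (inord (size w))) // => i.
by apply/eqP/eqP => [->|->]; rewrite ?inord_val ?inordK.
Qed.

Lemma letters_growth n : growth letters n = size (lang_words n).
Proof.
rewrite /growth letters_growth_space; apply/dimE/has_dim_supp_in.
  exact: lang_words_uniq.
by apply/allP => w; rewrite mem_lang_words => /andP[].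
Qed.

Lemma letters_finite_dim : finite_dim letters.
Proof.
pose s := [seq w <- lang_words 1 | size w == 1%N].
exists (size s); suff -> : letters = supp_in (mem s).
  apply: has_dim_supp_in; first by rewrite filter_uniq ?lang_words_uniq.
  by apply/allP => w; rewrite mem_filter mem_lang_words => /and3P[].
apply/seteqP; split=> a a1 w aw; last first.
  by have := a1 w aw; rewrite /= mem_filter => /andP[].
rewrite /= mem_filter mem_lang_words (eqP (a1 w aw)) eqxx andbT /=.
by apply: contraNT aw => /coef_lang ->.
Qed.

Lemma letters_generate : generates letters.
Proof.
apply/seteqP; split=> // a _ B [[B1 BD BM] SB].
have subB : subspace B by apply: GRing.subalg_closedZ.
apply: (subspace_words (P := predT)) => // w + _.
elim: w => [|x w IHw] Lxw; first by rewrite word_nil; rewrite inE in B1.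
have /andP[_ Lw] := @lang_cat _ L [:: x] w Lxw.
have := BM (word [:: x]) (word w); rewrite word_cat // !inE; apply; last exact: IHw.
by apply: SB; apply: supp_in_word.
Qed.

Lemma monalg_fg_with_growth (f : nat -> nat) :
  growth_equiv (fun n => size (lang_words n)) f -> fg_with_growth A f.
Proof.
move=> Lf; exists letters; split.
- exact: supp_in_subspace.
- exact: letters_finite_dim.
- exact: letters_generate.
by rewrite (_ : growth letters = fun n => size (lang_words n)) //;
  apply/funext => n; apply: letters_growth.
Qed.

End MonomialGrowth.

(** * Factors of concatenations and the construction of blocks *)

Lemma infix_catP (T : eqType) (w u v : seq T) : infix w (u ++ v) ->
  [\/ infix w u, infix w v |
      exists w1 w2, [/\ w = w1 ++ w2, suffix w1 u & prefix w2 v]].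
Proof.
elim: u => [|x u IHu]; first by constructor 2.
rewrite cat_cons infix_consl => /orP[|/IHu[wu|wv|[w1 [w2 [eq_w w1u w2v]]]]].
(* Here [w] starts at the first letter: it fits in the left word, or contains all of it, which then
   serves as [w1]. *)
- rewrite -cat_cons; move: (x :: u) => {IHu}u.
  have [le_wu|/ltnW le_uw] := leqP (size w) (size u).
    by rewrite prefixE takel_cat // -prefixE => /prefixW; constructor 1.
  rewrite prefixE take_cat ltnNge le_uw /= => /eqP <-; constructor 3.
  by exists u, (take (size w - size u) v); rewrite suffix_refl prefix_take.
- by constructor 1; rewrite infix_consl wu orbT.
- by constructor 2.
constructor 3; exists w1, w2; split=> //.
by rewrite -cat1s suffix_catr.
Qed.

Section BlockLanguage.
Local Open Scope nat_scope.
Variables (f : nat -> nat).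
Hypothesis f_gt0 : forall n, 0 < f n.
Hypothesis f_submul : forall m n, f (m + n) <= f m * f n.
Hypothesis f_incr : forall n, f n <= f n.+1.
Local Notation I := 'I_(f 1).
Implicit Types (u v w x : seq I).

(* The quotient is the ceiling of f (2 ^ k.+1) / size W, the least number of
   heads that makes blocks k.+1 have at least f (2 ^ k.+1) elements. *)
Definition heads (k : nat) (W : seq (seq I)) : seq (seq I) :=
  take ((f (2 ^ k.+1)).-1 %/ size W).+1 W.

Fixpoint blocks (k : nat) : seq (seq I) :=
  if k is j.+1 then [seq u ++ v | u <- heads j (blocks j), v <- blocks j]
  else [seq [:: i] | i : I].

Local Notation block_heads k := (heads k (blocks k)).

Lemma blocksS k : blocks k.+1 = [seq u ++ v | u <- block_heads k, v <- blocks k].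
Proof. by []. Qed.

Lemma sub_heads k : {subset block_heads k <= blocks k}.
Proof. exact: mem_take. Qed.

Lemma size_block k w : w \in blocks k -> size w = 2 ^ k.
Proof.
elim: k w => [w /mapP[i _ ->] //|k IHk w].
rewrite blocksS => /allpairsP[[u v] [/= /sub_heads/IHk uk /IHk vk ->]].
by rewrite size_cat uk vk addnn -mul2n expnS.
Qed.

Lemma blocks_uniq k : uniq (blocks k).
Proof.
elim: k => [|k IHk]; first by rewrite map_inj_uniq ?enum_uniq // => i j [].
rewrite blocksS allpairs_uniq ?take_uniq // => -[u v] [u' v'].
move=> /allpairsP[[? ?] [/= /sub_heads/size_block uk _ [-> ->]]].
move=> /allpairsP[[? ?] [/= /sub_heads/size_block u'k _ [-> ->]]] /eqP.
by rewrite eqseq_cat ?uk ?u'k // => /andP[/eqP-> /eqP->].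
Qed.

Lemma leq_f : {homo f : m n / m <= n}.
Proof. by apply: homo_leq => // ? ? ?; apply: leq_trans. Qed.

(** By submultiplicativity [f (2 ^ k.+1)] is at most the square of [size (blocks k)], so there are
    enough blocks to supply the heads requested and [take] does not fall short. *)
Lemma size_heads_blocks k : f (2 ^ k) <= size (blocks k) ->
  size (block_heads k) = ((f (2 ^ k.+1)).-1 %/ size (blocks k)).+1.
Proof.
move=> le_f; rewrite size_takel // ltn_divLR; last exact: leq_trans le_f.
rewrite prednK // expnS mul2n -addnn (leq_trans (f_submul _ _)) //.
exact: leq_mul.
Qed.

Lemma size_blocksS k :
  size (blocks k.+1) = size (block_heads k) * size (blocks k).
Proof. by rewrite blocksS size_allpairs. Qed.

Lemma leq_size_blocks k : f (2 ^ k) <= size (blocks k).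
Proof.
elim: k => [|k IHk]; first by rewrite size_map -cardE card_ord.
rewrite size_blocksS size_heads_blocks // -(prednK (f_gt0 _)) ltn_ceil //.
exact: leq_trans IHk.
Qed.

(** Rounding the number of heads up costs at most one extra copy of [blocks k]. Hence the size is at
    most the sum of [f (2 ^ i)] for [i <= k], each term being at most [f (2 ^ k)]. *)
Lemma size_blocks_leq k : size (blocks k) <= k.+1 * f (2 ^ k).
Proof.
elim: k => [|k IHk]; first by rewrite size_map -cardE card_ord mul1n.
rewrite size_blocksS size_heads_blocks ?leq_size_blocks // mulSnr [k.+2 * _]mulSn.
rewrite leq_add ?(leq_trans (leq_trunc_div _ _)) ?leq_pred //.
by rewrite (leq_trans IHk) // leq_mul2l leq_f ?leq_pexp2l.
Qed.

Lemma has_head k : exists u, u \in block_heads k.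
Proof.
have := size_heads_blocks (leq_size_blocks k).
by case: (block_heads k) => // u s _; exists u; rewrite mem_head.
Qed.

(** * The language of factors of blocks and its short words *)

Definition block_factor w : bool :=
  `[< exists k x, x \in blocks k /\ infix w x >].

Fact block_factor_nil : block_factor [::].
Proof.
by apply/asboolP; exists 0, [:: Ordinal (f_gt0 1)]; rewrite infix0s map_f ?mem_enum.
Qed.

Fact block_factor_cat u v : block_factor (u ++ v) -> block_factor u && block_factor v.
Proof.
move=> /asboolP[k [x [xk uvx]]]; apply/andP; split; apply/asboolP; exists k, x.
  by rewrite (catr_infix uvx).
by rewrite (catl_infix uvx).
Qed.

Definition block_lang : language I := Language block_factor_nil block_factor_cat.

Lemma take_block k d x : x \in blocks (d + k) -> take (2 ^ k) x \in blocks k.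
Proof.
elim: d x => [|d IHd] x; first by move=> xk; rewrite take_oversize ?(size_block xk).
rewrite addSn blocksS => /allpairsP[[u v] [/= /sub_heads udk _ ->]].
by rewrite takel_cat ?IHd // (size_block udk) leq_pexp2l ?leq_addl.
Qed.

(** Following left halves down to order [k.+1], the next left half is a head by construction. This
    needs order above [k], hence [d.+1]: a block of order [k] need not be a head. *)
Lemma take_block_head k d x :
  x \in blocks (d.+1 + k) -> take (2 ^ k) x \in block_heads k.
Proof.
elim: d x => [|d IHd] x; rewrite addSn blocksS.
  move=> /allpairsP[[u v] [/= uk _ ->]].
  by rewrite take_size_cat // (size_block (sub_heads uk)).
move=> /allpairsP[[u v] [/= /sub_heads udk _ ->]].
by rewrite takel_cat ?IHd // (size_block udk) leq_pexp2l ?leq_addl.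
Qed.

Lemma drop_block k d x :
  x \in blocks (d + k) -> drop (size x - 2 ^ k) x \in blocks k.
Proof.
elim: d x => [|d IHd] x; first by move=> xk; rewrite (size_block xk) subnn drop0.
rewrite addSn blocksS => /allpairsP[[u v] [/= /sub_heads udk vdk ->]].
have le_v : 2 ^ k <= size v by rewrite (size_block vdk) leq_pexp2l ?leq_addl.
rewrite size_cat -addnBA // addnC -drop_drop drop_size_cat //.
exact: IHd.
Qed.

(** The pairs of consecutive blocks of order [k] that can occur: head then block, or block then
    head. *)
Definition junctions (k : nat) : seq (seq I) :=
  blocks k.+1 ++ [seq u ++ v | u <- blocks k, v <- block_heads k].

(** Descend into halves until [w] crosses the middle or order [k] is reached. A crossing word is
    short enough to lie in the last block of order [k] on the left followed by the first one on the
    right. *)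
Lemma block_factor_junction k w : block_factor w -> size w <= 2 ^ k ->
  exists2 x, x \in junctions k & infix w x.
Proof.
move=> /asboolP[j [x [xj wx]]] le_w.
(* A block of order below [k] is enlarged by prepending heads, so the order may be taken to be at
   least [k]. *)
have [d [y [{x xj wx}yj wy]]] : exists d y, y \in blocks (d + k) /\ infix w y.
  have [le_kj|/ltnW le_jk] := leqP k j.
    by exists (j - k), x; rewrite subnK.
  exists 0; rewrite add0n -(subnK le_jk); move: (k - j) => d.
  elim: d => [|d [y [yd wy]]]; first by exists x.
  have [u ud] := has_head (d + j); exists (u ++ y); split.
    by rewrite addSn blocksS allpairs_f.
  by rewrite infix_catl.
elim: d y yj wy => [|d IHd] y.
  move=> yk wy; have [u uk] := has_head k; exists (u ++ y).
    by rewrite mem_cat blocksS allpairs_f.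
  by rewrite infix_catl.
rewrite addSn blocksS => /allpairsP[[u v] [/= ud vd ->]].
case/infix_catP => [wu|wv|[w1 [w2 [eq_w w1u w2v]]]].
- exact: IHd (sub_heads ud) wu.
- exact: IHd vd wv.
exists (drop (size u - 2 ^ k) u ++ take (2 ^ k) v).
  (* Halves of order exactly [k] form a head followed by a block; halves of larger order meet in a
     block followed by a head. *)
  rewrite mem_cat; case: d {IHd} ud vd => [|d] ud vd.
    rewrite blocksS allpairs_f //=.
      by rewrite (size_block (sub_heads ud)) subnn drop0.
    exact: (@take_block k 0).
  apply/orP; right; apply: allpairs_f; last exact: take_block_head vd.
  exact: (@drop_block k d.+1) (sub_heads ud).
have /andP[le_w1 le_w2] : (size w1 <= 2 ^ k) && (size w2 <= 2 ^ k).
  move: le_w; rewrite eq_w size_cat => le_w12.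
  by rewrite !(leq_trans _ le_w12) ?leq_addl ?leq_addr.
have /suffixP[p ->] : suffix w1 (drop (size u - 2 ^ k) u).
  have le_u : 2 ^ k <= size u.
    by rewrite (size_block (sub_heads ud)) leq_pexp2l ?leq_addl.
  move: w1u; rewrite !suffixE drop_drop size_drop.
  suff -> : size u - (size u - 2 ^ k) - size w1 + (size u - 2 ^ k) =
            size u - size w1 by [].
  by rewrite subKn // addnC addnBA // subnK.
have /prefixP[s ->] : prefix w2 (take (2 ^ k) v).
  by move: w2v; rewrite !prefixE take_takel.
by apply/infixP; exists p, s; rewrite eq_w !catA.
Qed.

Lemma size_junctions k : size (junctions k) = 2 * size (blocks k.+1).
Proof.
by rewrite size_cat size_allpairs mulnC -size_blocksS addnn mul2n.
Qed.

Lemma size_junction k x : x \in junctions k -> size x = 2 ^ k.+1.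
Proof.
rewrite mem_cat => /orP[/size_block//|].
move=> /allpairsP[[u v] [/= /size_block uk /sub_heads/size_block vk ->]].
by rewrite size_cat uk vk addnn -mul2n expnS.
Qed.

(** * Counting the words and comparing with [f] *)

Lemma leq_size_lang_words k :
  size (blocks k) <= size (lang_words block_lang (2 ^ k)).
Proof.
apply: uniq_leq_size (blocks_uniq k) _ => w wk.
rewrite mem_lang_words (size_block wk) leqnn andbT.
by apply/asboolP; exists k, w; rewrite infix_refl.
Qed.

(** A word of length at most [n] is recovered from a junction, a starting position and a length, the
    last two ranging over [0] to [2 ^ k.+1] inclusive. *)
Lemma size_lang_words_leq n k : n <= 2 ^ k ->
  size (lang_words block_lang n) <=
  2 * size (blocks k.+1) * ((2 ^ k.+1).+1 * (2 ^ k.+1).+1).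
Proof.
move=> le_nk; set M := (2 ^ k.+1).+1.
pose pos := [seq (p, l) | p <- iota 0 M, l <- iota 0 M].
pose W := [seq take pl.2 (drop pl.1 x) | x <- junctions k, pl <- pos].
have -> : 2 * size (blocks k.+1) * (M * M) = size W.
  by rewrite [size W]size_allpairs size_junctions [size pos]size_allpairs size_iota.
apply: uniq_leq_size (lang_words_uniq _ _) _ => w; rewrite mem_lang_words.
move=> /andP[/block_factor_junction-/(_ k) ex_x le_wn].
have [x xk wx] := ex_x (leq_trans le_wn le_nk).
have sx := size_junction xk; case/infixP: wx => p [s eq_x].
apply/allpairsP; exists (x, (size p, size w)); split=> //=.
  apply: allpairs_f; rewrite mem_iota ltnS -sx eq_x !size_cat ?leq_addr //.
  by rewrite addnCA leq_addr.
by rewrite eq_x drop_size_cat ?take_size_cat.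
Qed.

(** Each further use of the hypothesis is at [C ^ a * n], which is at least [n], and so gains at
    least a factor [n]. *)
Lemma iter_growth C : (forall n, n * f n <= f (C * n)) ->
  forall a n, 0 < C -> n ^ a * f n <= f (C ^ a * n).
Proof.
move=> f_C; elim=> [|a IHa] n C_gt0; first by rewrite !mul1n.
rewrite !expnS -!mulnA (leq_trans _ (f_C _)) //.
by rewrite leq_mul ?IHa // leq_pmull // expn_gt0 C_gt0.
Qed.

Lemma lang_words_growth :
  (exists2 C, 0 < C & forall n, n * f n <= f (C * n)) ->
  growth_equiv (fun n => size (lang_words block_lang n)) f.
Proof.
have dyadic n : 0 < n -> exists k, n <= 2 ^ k <= 2 * n.
  move=> n_gt0; exists (trunc_log 2 n).+1.
  have /andP[le_n lt_n] := trunc_log_bounds (leqnn 2) n_gt0.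
  by rewrite ltnW //= expnS leq_mul2l.
case=> C C_gt0 f_C; split.
  (* Six uses of the hypothesis on [C] absorb the factor [M ^ 6] found below, and [M = 2 ^ k.+1] is
     at most [4 * n]. *)
  exists (C ^ 6 * 4) => [|n /dyadic[k /andP[le_nk le_kn]]].
    by rewrite muln_gt0 expn_gt0 C_gt0.
  apply: leq_trans (size_lang_words_leq le_nk) _.
  set M := 2 ^ k.+1.
  have M_gt1 : 1 < M by rewrite /M expnS leq_pmulr // expn_gt0.
  have le_W : size (blocks k.+1) <= M * f M.
    by rewrite (leq_trans (size_blocks_leq _)) // leq_mul2r ltn_expl // orbT.
  have le_M : M.+1 <= M ^ 2 by nia.
  (* The factor [2] costs one power of [M], the bound on the blocks another, and the two factors
     [M.+1] cost two each. *)
  apply: (@leq_trans (M ^ 6 * f M)).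
    have -> : M ^ 6 * f M = M * (M * f M) * (M ^ 2 * M ^ 2).
      by rewrite !expnS expn0; lia.
    by rewrite !leq_mul.
  apply: leq_trans (iter_growth f_C 6 M C_gt0) _.
  rewrite leq_f // -mulnA leq_mul2l; apply/orP; right.
  by rewrite /M expnS; lia.
(* For the lower bound, the blocks of order [k] alone suffice; their length [2 ^ k] is at most
   [2 * n]. *)
exists 2 => // n /dyadic[k /andP[le_nk le_kn]].
apply: leq_trans (leq_f le_nk) _.
apply: leq_trans (leq_size_blocks k) _.
apply: leq_trans (leq_size_lang_words k) _.
apply: uniq_leq_size (lang_words_uniq _ _) _ => w.
by rewrite !mem_lang_words => /andP[-> /leq_trans->].
Qed.

End BlockLanguage.

Theorem corollary4 (K : closedFieldType) (f : nat -> nat)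
  (f_gt0 : forall n, (0 < f n)%N)
  (f_submul : forall m n, (f (m + n) <= f m * f n)%N)
  (f_incr : forall n, (f n <= f n.+1)%N)
  (f_C : exists2 C : nat, (0 < C)%N & forall n, (n * f n <= f (C * n))%N) :
  exists A : algType K, fg_with_growth A f.
Proof.
exists (monalg K (block_lang f_gt0)); apply: monalg_fg_with_growth.
exact: lang_words_growth.
Qed.
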